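(* For every loopless matroid $M$, the volume polynomial $VP^\nabla_M\in\mathbb R[t_F: F\in\mathscr L_M^{\ge2}]$ is Lorentzian.
   Context: $M$ is a loopless matroid of rank $d+1$ on $E$, $\mathscr L_M^{\ge2}$ its set of flats of rank $\ge2$. $A^\bullet(M)=\mathbb R[x_F: F\text{ nonempty proper flat}]/(\langle x_Fx_{F'}: F,F'\text{ incomparable}\rangle+\langle\sum_{F\ni i}x_F-\sum_{F\ni j}x_F\rangle)$ with degree map $\int_M x_{F_1}\cdots x_{F_d}=1$ for maximal chains; $h_F=\alpha-\sum_{F\subseteq G\subsetneq E}x_G$ with $\alpha=\sum_{G\ni i}x_G$; $VP^\nabla_M(\underline t)=\int_M(\sum_{F\in\mathscr L_M^{\ge2}}t_Fh_F)^d$. A homogeneous polynomial $f\in\mathbb R[x_1,\dots,x_m]$ of degree $d$ is strictly Lorentzian if all degree-$d$ monomials appear with positive coefficients and the Hessian of every $(d-2)$-nd order partial derivative $\partial_{i_1}\cdots\partial_{i_{d-2}}f$ has signature $(+,-,\dots,-)$; Lorentzian polynomials are limits of strictly Lorentzian polynomials (equivalently, for $f$ with nonnegative coefficients: the support of $f$ is M-convex and every Hessian of a $(d-2)$-nd partial derivative has at most one positive eigenvalue). *)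

(* Defs.v *)
From HB Require Import structures.
From mathcomp Require Import all_boot all_order all_algebra.
From mathcomp Require Import reals.
From mathcomp.multinomials Require Import mpoly.

Set Implicit Arguments.
Unset Strict Implicit.
Unset Printing Implicit Defensive.

Import Order.TTheory GRing.Theory Num.Theory.

Record matroid (E : finType) := Matroid {
  mrank : {set E} -> nat;
  mrank_card : forall A : {set E}, (mrank A <= #|A|)%N;
  mrank_mono : forall A B : {set E}, A \subset B -> (mrank A <= mrank B)%N;
  mrank_submod : forall A B : {set E},
      (mrank (A :|: B) + mrank (A :&: B) <= mrank A + mrank B)%N }.

Section MatroidDefs.
Variables (E : finType) (M : matroid E).

Definition loopless : Prop := forall e : E, (0 < mrank M [set e])%N.

Definition is_flat (F : {set E}) : bool :=
  [forall e, (e \notin F) ==> (mrank M F < mrank M (e |: F))%N].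

Definition npflat_pred (F : {set E}) : bool :=
  [&& is_flat F, F != set0 & F != setT].
Definition npflat : finType := {F : {set E} | npflat_pred F}.

Definition flat2_pred (F : {set E}) : bool := is_flat F && (2 <= mrank M F)%N.
Definition flat2 : finType := {F : {set E} | flat2_pred F}.

End MatroidDefs.

Local Open Scope ring_scope.

Section Chow.
Variables (R : realType) (E : finType) (M : matroid E).

Definition xring := {mpoly R[#|npflat M|]}.

Definition xvar (F : npflat M) : xring := 'X_(enum_rank F).

Definition chow_gen (p : xring) : Prop :=
  (exists F G : npflat M,
      [&& ~~ (val F \subset val G) & ~~ (val G \subset val F)] /\ p = xvar F * xvar G)
  \/ (exists i j : E,
      p = \sum_(F : npflat M | i \in val F) xvar F
          - \sum_(F : npflat M | j \in val F) xvar F).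

Definition chow_ideal (p : xring) : Prop :=
  exists s : seq (xring * xring),
    (forall q, q \in s -> chow_gen q.2) /\ p = \sum_(q <- s) q.1 * q.2.

Definition is_chain (C : {set npflat M}) : Prop :=
  forall F G, F \in C -> G \in C -> (val F \subset val G) || (val G \subset val F).

Definition max_chain (C : {set npflat M}) : Prop :=
  is_chain C /\ forall C', is_chain C' -> C \subset C' -> C' = C.

(* [deg] is the degree map int_M : A^d(M) -> R, pulled back to the polynomial
   ring and extended by zero to the other graded pieces: it is linear, kills
   the ideal, kills homogeneous elements of degree <> d, and sends the
   monomial of every maximal chain of nonempty proper flats to 1. *)
Definition degree_map (d : nat) (deg : xring -> R) : Prop :=
  [/\ forall p q, deg (p + q) = deg p + deg q,
      forall (c : R) p, deg (c *: p) = c * deg p,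
      forall p, chow_ideal p -> deg p = 0,
      forall (k : nat) p, k != d -> p \is k.-homog -> deg p = 0
    & forall C, max_chain C -> deg (\prod_(F in C) xvar F) = 1].

Definition alpha (i : E) : xring := \sum_(G : npflat M | i \in val G) xvar G.

Definition hclass (i : E) (F : flat2 M) : xring :=
  alpha i - \sum_(G : npflat M | val F \subset val G) xvar G.

Definition thsum (i : E) : {mpoly xring[#|flat2 M|]} :=
  \sum_(F : flat2 M) (hclass i F)%:MP * 'X_(enum_rank F).

Definition volume_poly (d : nat) (deg : xring -> R) (i : E) : {mpoly R[#|flat2 M|]} :=
  let P := thsum i ^+ d in
  \sum_(a <- msupp P) deg (P@_a) *: 'X_[a].

End Chow.

Section Lorentzian.
Variables (R : realType) (n : nat).

(* Hessian of a polynomial (constant entries when q is quadratic) *)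
Definition hessian (q : {mpoly R[n]}) : 'M[R]_n :=
  \matrix_(j, k) (mderiv j (mderiv k q))@_0%MM.

Definition lorentz_signature (H : 'M[R]_n) : Prop :=
  exists lam : 'I_n -> R,
    [/\ char_poly H = \prod_(i < n) ('X - (lam i)%:P),
        #|[set i | 0 < lam i]| = 1%N
      & #|[set i | lam i < 0]| = n.-1].

Definition strictly_lorentzian (d : nat) (f : {mpoly R[n]}) : Prop :=
  [/\ f \is d.-homog,
      forall a : 'X_{1..n}, mdeg a = d -> 0 < f@_a
    & (2 <= d)%N -> forall s : (d - 2)%N.-tuple 'I_n,
        lorentz_signature (hessian (foldr (fun i p => mderiv i p) f s))].

Definition lorentzian (d : nat) (f : {mpoly R[n]}) : Prop :=
  forall eps : R, 0 < eps ->
    exists g : {mpoly R[n]}, strictly_lorentzian d g /\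
      forall a : 'X_{1..n}, `|f@_a - g@_a| < eps.

End Lorentzian.

(* Main.v *)
Require Import Defs.
From HB Require Import structures.
From mathcomp Require Import all_boot all_order all_algebra.
From mathcomp Require Import zify ring lra.
From mathcomp Require Import reals complex.
From mathcomp.multinomials Require Import mpoly.

(* Multiplication by h_F acts on chains of flats as the principal truncation of
   the matroid along F, so a product of d classes h_F has degree 1 if each
   successive truncation lowers the rank and degree 0 otherwise. Let r_a be the
   rank function obtained from M by truncating along the multiset a of flats.
   Then a! times the coefficient of t^a in the volume polynomial is d! when
   r_a(E) = 1, and 0 otherwise. Replacing it by
   d! delta^(r_a(E) - 1) theta^(sum_F a_F^2) with delta -> 0 and theta -> 1 gives
   strictly Lorentzian polynomials converging to it: truncating further along F
   and G lowers the rank by 2 unless one of them has become a loop or both are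
   parallel, and since parallelism is transitive, every Hessian is, after a positive
   diagonal scaling, the all-ones matrix minus a positive definite one. *)

Set Implicit Arguments.
Unset Strict Implicit.
Unset Printing Implicit Defensive.

Import Order.TTheory GRing.Theory Num.Theory.

(** * Rank functions and principal truncation *)

Section RankFunctions.
Variable E : finType.
Implicit Types (A B F G H X Y : {set E}) (r : {ffun {set E} -> nat}).

(** These are the rank functions of loopless matroids; the bound by cardinality follows from
    submodularity and the value on singletons. *)
Definition rankfun r :=
  [/\ r set0 = 0, forall e, r [set e] = 1,
      forall A B, A \subset B -> r A <= r B
    & forall A B, r (A :|: B) + r (A :&: B) <= r A + r B].

Definition flatr r X := [forall e, (e \notin X) ==> (r X < r (e |: X))].

Lemma flatrP r X :
  reflect (forall e, e \notin X -> r X < r (e |: X)) (flatr r X).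
Proof.
by apply: (iffP forallP) => h e; [move=> eX; exact: (implyP (h e)) | apply/implyP/h].
Qed.

Lemma flatr_ltn r X Y : rankfun r -> flatr r X -> ~~ (Y \subset X) ->
  r X < r (X :|: Y).
Proof.
move=> [_ _ mono _] /flatrP fX /subsetPn[e eY eX].
apply: leq_trans (fX e eX) (mono _ _ _).
by rewrite setUC setUS // sub1set.
Qed.

Lemma rankfun_gt0 r X : rankfun r -> (0 < r X) = (X != set0).
Proof.
move=> [r0 r1 mono _]; have [->|[e eX]] := set_0Vmem X; first by rewrite r0 eqxx.
rewrite (leq_trans _ (mono [set e] X _)) ?r1 ?sub1set //.
by apply/esym/set0Pn; exists e.
Qed.

Lemma rankfunU1 r A e : rankfun r -> r (e |: A) <= (r A).+1.
Proof. by move=> [_ r1 _ sub]; have := sub [set e] A; rewrite r1; lia. Qed.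

(** The closure is a largest set containing [A] with the same rank: maximality makes it a flat, and
    submodularity puts it inside every flat containing [A]. *)
Lemma closure_ex r A : rankfun r ->
  exists G, [/\ flatr r G, A \subset G, r G = r A &
    forall X, flatr r X -> A \subset X -> G \subset X].
Proof.
move=> rk; have [_ _ mono sub] := rk.
have PA : (A \subset A) && (r A == r A) by rewrite subxx eqxx.
have [B /andP[AB /eqP rB] maxB] :=
  @arg_maxnP _ A (fun B => (A \subset B) && (r B == r A)) (fun B => #|B|) PA.
exists B; split=> //.
  apply/flatrP => e eB; rewrite ltnNge; apply/negP => le.
  have /maxB : (A \subset e |: B) && (r (e |: B) == r A).
    by rewrite subsetU ?AB ?orbT //= eqn_leq -{1}rB le mono // subsetU ?AB ?orbT.
  by rewrite cardsU1 eB; lia.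
move=> X fX AX; apply/negPn/negP => /(flatr_ltn rk fX).
have := sub X B; have : r A <= r (X :&: B) by apply: mono; rewrite subsetI AX.
lia.
Qed.

Lemma flatr_eq r X Y : rankfun r -> flatr r X -> X \subset Y -> r Y <= r X -> X = Y.
Proof.
move=> rk fX XY le; apply/eqP; rewrite eqEsubset XY /=.
by apply/negPn/negP => /(flatr_ltn rk fX); rewrite (setUidPr XY); lia.
Qed.

(* The principal truncation of [r] along [F], read as doing nothing when [F] has
   rank at most one. *)
Definition trunc F r : {ffun {set E} -> nat} :=
  if 2 <= r F then [ffun A => minn (r A) (r (A :|: F)).-1] else r.

Lemma truncE F r A :
  trunc F r A = if 2 <= r F then minn (r A) (r (A :|: F)).-1 else r A.
Proof. by rewrite /trunc; case: ifP; rewrite ?ffunE. Qed.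

(** Rank at least two for [F] keeps singletons at rank one. For submodularity, [h0] to [h3] cover
    the four ways in which the minima for [A] and [B] are attained. *)
Lemma trunc_rankfun F r : rankfun r -> rankfun (trunc F r).
Proof.
move=> rk; have [r0 r1 mono sub] := rk; rewrite /trunc; case: ifP => // F2.
have rF A : 2 <= r (A :|: F) by apply: leq_trans F2 (mono _ _ _); rewrite subsetUr.
split; [|move=> e|move=> A B AB|move=> A B]; rewrite !ffunE.
- by rewrite r0 min0n.
- by rewrite r1; have := rF [set e]; lia.
- by have := mono _ _ AB; have := mono _ _ (setSU F AB); lia.
have h0 := sub A B.
have := sub (A :|: F) B; rewrite setUAC => h1.
have := sub A (B :|: F); rewrite setUA => h2.
have := sub (A :|: F) (B :|: F); rewrite -setUUl -setUIl => h3.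
have m1 : r (A :&: B) <= r ((A :|: F) :&: B) by rewrite mono // setSI // subsetUl.
have m2 : r (A :&: B) <= r (A :&: (B :|: F)) by rewrite mono // setIS // subsetUl.
have := rF A; have := rF B; have := rF (A :|: B); have := rF (A :&: B); lia.
Qed.

(** Let [F] and [G] have rank at least two. If their union has rank at least three, both sides are
    the minimum of [r A], [r (A :|: F) - 1], [r (A :|: G) - 1] and [r (A :|: F :|: G) - 2].
    Otherwise [F] and [G] span the same flat: the two truncations coincide, and each reduces the
    other set to rank one. *)
Lemma truncC F G r : rankfun r -> trunc F (trunc G r) = trunc G (trunc F r).
Proof.
move=> rk; have [_ _ mono sub] := rk; apply/ffunP => A.
have predn_min x y : (minn x y).-1 = minn x.-1 y.-1 by rewrite -!subn1 subn_minl.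
rewrite !truncE !(setUC G F) !(setUAC A G F).
have [F2|/ltn_geF F1] := leqP 2 (r F); have [G2|/ltn_geF G1] := leqP 2 (r G);
  rewrite ?leq_min ?F1 ?F2 ?G1 ?G2 //=.
case: ifP => FG; first by rewrite !predn_min minnACA.
have small : r (F :|: G) <= 2 by move/negbT: FG; case: (r _) => [|[|[|?]]].
have full X : 2 <= r X -> X \subset F :|: G -> r (A :|: X) = r (A :|: (F :|: G)).
  move=> X2 XFG; apply/eqP; rewrite eqn_leq mono ?setUS //=.
  have := sub (A :|: X) (F :|: G); rewrite -setUA (setUidPr XFG).
  have : r X <= r ((A :|: X) :&: (F :|: G)) by rewrite mono // subsetI subsetUr.
  lia.
by rewrite !full ?subsetUl ?subsetUr.
Qed.

Lemma trunc_setT F r : rankfun r -> (2 <= r F) + trunc F r setT = r setT.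
Proof.
move=> rk; have [_ _ mono _] := rk; rewrite truncE setTU.
by have := mono _ _ (subsetT F); case: ifP; lia.
Qed.

(** This and the next three lemmas describe the flats of the truncation: for [F] of rank at least
    two, a flat [X] of [r] survives exactly when it contains [F] or adjoining [F] raises its rank by
    at least two. *)
Lemma trunc_flat F r X : rankfun r -> flatr (trunc F r) X -> flatr r X.
Proof.
move=> rk /flatrP fX; have [_ _ mono sub] := rk; apply/flatrP => e eX.
have := fX e eX; rewrite !truncE; case: ifP => // F2.
have := mono _ _ (subsetUr [set e] X).
have := sub (e |: X) (X :|: F); rewrite setUA -(setUA [set e] X X) setUid.
have : r X <= r ((e |: X) :&: (X :|: F)) by rewrite mono // subsetI subsetUr subsetUl.
have := mono _ _ (subsetUr [set e] (X :|: F)); rewrite setUA.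
lia.
Qed.

Lemma trunc_flat_sub F r X : rankfun r -> 2 <= r F -> F \subset X ->
  flatr r X -> flatr (trunc F r) X.
Proof.
move=> rk F2 FX /flatrP fX; have [_ _ mono _] := rk; apply/flatrP => e eX.
rewrite !truncE F2 (setUidPl FX) (setUidPl (subset_trans FX (subsetUr _ _))).
by have := fX e eX; have := mono _ _ FX; lia.
Qed.

Lemma trunc_flat_gap F r X : rankfun r -> flatr r X -> r X + 2 <= r (X :|: F) ->
  flatr (trunc F r) X.
Proof.
move=> rk /flatrP fX gap; have [_ _ mono _] := rk; apply/flatrP => e eX.
rewrite !truncE; have := fX e eX.
have : r (X :|: F) <= r ((e |: X) :|: F) by rewrite mono // setSU // subsetUr.
case: ifP; lia.
Qed.

Lemma trunc_gap F r X : rankfun r -> 2 <= r F -> flatr (trunc F r) X ->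
  ~~ (F \subset X) -> r X + 2 <= r (X :|: F).
Proof.
move=> rk F2 fX' FX; have fX := trunc_flat rk fX'.
have lt := flatr_ltn rk fX FX; have [e eF eX] := subsetPn FX.
(* Adding [e] to [X] leaves [X :|: F] unchanged, so with a gap of one the truncated rank could not
   rise. *)
have := flatrP _ _ fX' e eX; rewrite !truncE F2.
have -> : (e |: X) :|: F = X :|: F.
  by rewrite -setUA; apply/setUidPr; rewrite sub1set inE eF orbT.
have := rankfunU1 X e rk; lia.
Qed.

Lemma flatr0 r : rankfun r -> flatr r set0.
Proof. by case=> r0 r1 _ _; apply/flatrP => e _; rewrite setU0 r0 r1. Qed.

Lemma foldr_trunc_rankfun r s : rankfun r -> rankfun (foldr trunc r s).
Proof. by move=> rk; elim: s => //= F s; apply: trunc_rankfun. Qed.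

(** Since truncations commute, the result depends only on the multiset of flats, and any one of them
    may be taken as the last. *)
Lemma foldr_trunc_perm r s1 s2 : rankfun r -> perm_eq s1 s2 ->
  foldr trunc r s1 = foldr trunc r s2.
Proof.
move=> rk; elim: s1 s2 => [|F s1 IH] s2.
  by move/perm_size/esym/size0nil->.
move=> p; have /path.splitPr sF : F \in s2 by rewrite -(perm_mem p) mem_head.
case: sF p => t u p.
have /IH /= -> : perm_eq s1 (t ++ u).
  by rewrite -(perm_cons F) (perm_trans p) // (perm_catCA t [:: F] u).
elim: t {p} => //= G t <-; rewrite truncC //; exact: foldr_trunc_rankfun.
Qed.

Lemma foldr_trunc_flat r s X : rankfun r -> flatr (foldr trunc r s) X -> flatr r X.
Proof.
move=> rk; elim: s => //= F s IH /trunc_flat h; apply: IH; apply: h.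
exact: foldr_trunc_rankfun.
Qed.

Lemma foldr_trunc_setT r s : rankfun r ->
  r setT <= foldr trunc r s setT + size s.
Proof.
move=> rk; elim: s => [|F s IH] /=; first by rewrite addn0.
have := trunc_setT F (foldr_trunc_rankfun s rk); lia.
Qed.

Lemma foldr_trunc_setT_gt0 r s : rankfun r -> 0 < r setT ->
  0 < foldr trunc r s setT.
Proof.
by move=> rk; rewrite !rankfun_gt0 //; exact: foldr_trunc_rankfun.
Qed.

(** The last bracket is the parallel case: truncating along [F] brings [G] down to rank one, so the
    second truncation does nothing. *)
Lemma trunc_trunc_setT F G r : rankfun r ->
  trunc G (trunc F r) setT + (2 <= r F) + (2 <= r G) =
  r setT + [&& 2 <= r F, 2 <= r G & r (F :|: G) <= 2].
Proof.
move=> rk; have [_ _ mono _] := rk.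
have := trunc_setT G (trunc_rankfun F rk); have := trunc_setT F rk.
have := truncE F r G; rewrite setUC; have := mono _ _ (subsetUr F G).
case: (leqP 2 (r F)); case: (leqP 2 (r G)) => /=; lia.
Qed.

(** Transitivity of parallelism: the two unions both contain [G], which already has rank at least
    two, so submodularity bounds the rank of everything together. *)
Lemma rank2_trans r F G H : rankfun r -> 2 <= r G ->
  r (F :|: G) <= 2 -> r (G :|: H) <= 2 -> r (F :|: H) <= 2.
Proof.
move=> [_ _ mono sub] G2 FG GH; have := sub (F :|: G) (G :|: H).
have : r G <= r ((F :|: G) :&: (G :|: H)) by rewrite mono // subsetI subsetUr subsetUl.
have : r (F :|: H) <= r ((F :|: G) :|: (G :|: H)).
  by rewrite mono // subUset subsetU ?subsetUl // subsetU ?subsetUr ?orbT.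
lia.
Qed.

End RankFunctions.

(** * Chains of flats *)

Section Chains.
Variables (E : finType) (M : matroid E).
Implicit Types (C D : {set npflat M}) (G : npflat M).

Definition rank0 : {ffun {set E} -> nat} := [ffun A => mrank M A].

Lemma rank0_rankfun : loopless M -> rankfun rank0.
Proof.
move=> lM; split; [|move=> e|move=> A B|move=> A B]; rewrite !ffunE.
- by apply/eqP; rewrite -leqn0 -(@cards0 E) mrank_card.
- by apply/eqP; rewrite eqn_leq lM -(cards1 e) mrank_card.
- exact: mrank_mono.
exact: mrank_submod.
Qed.

Lemma rank0_flat X : flatr rank0 X = is_flat M X.
Proof. by apply: eq_forallb => e; rewrite !ffunE. Qed.

Definition chainb C :=
  [forall F in C, forall G in C, (val F \subset val G) || (val G \subset val F)].

Lemma chainP C : reflect (is_chain C) (chainb C).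
Proof.
apply: (iffP forall_inP) => h F; last by move=> FC; apply/forall_inP => G; apply: h.
by move=> G FC; move: G; apply/forall_inP; apply: h.
Qed.

Lemma chainbU1 G D : chainb D ->
  (forall X, X \in D -> (val G \subset val X) || (val X \subset val G)) ->
  chainb (G |: D).
Proof.
move=> /chainP cD h; apply/chainP => X Y /setU1P[->|XD] /setU1P[->|YD].
- by rewrite subxx.
- exact: h.
- by rewrite orbC h.
exact: cD.
Qed.

Definition flats_of (r : {ffun {set E} -> nat}) C := [forall G in C, flatr r (val G)].

(** The rank is injective on a chain of flats, with values from 1 to [r setT - 1]. *)
Lemma chain_card r C : rankfun r -> 0 < r setT -> chainb C -> flats_of r C -> #|C| < r setT.
Proof.
move=> rk rT /chainP cC /forall_inP fC; suff : #|C| <= (r setT).-1.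
  by move=> /leq_ltn_trans -> //; rewrite prednK.
rewrite cardE -(size_map (fun G => r (val G))) -(size_iota 1 (r setT).-1).
apply: uniq_leq_size.
  rewrite map_inj_in_uniq ?enum_uniq // => F G; rewrite !mem_enum => FC GC rFG.
  apply: val_inj; have /orP[sub|sub] := cC F G FC GC.
    by apply: (flatr_eq rk) sub _; rewrite ?fC ?rFG.
  by apply/esym; apply: (flatr_eq rk) sub _; rewrite ?fC ?rFG.
move=> k /mapP[G]; rewrite mem_enum => GC ->; rewrite mem_iota.
have /and3P[_ G0 GT] := valP G; rewrite rankfun_gt0 // G0 /=.
have := flatr_ltn rk (fC G GC) (Y := setT).
by rewrite setUT subTset add1n prednK // => /(_ GT).
Qed.

(** The set [A] is the largest member of [D] not containing [F], or empty if there is none; it marks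
    the place where the chain passes above [F]. *)
Lemma chain_split (F : {set E}) D : F != set0 -> chainb D ->
  exists A : {set E}, [/\ A = set0 \/ (exists2 X, X \in D & A = val X),
    ~~ (F \subset A),
    forall X, X \in D -> ~~ (F \subset val X) -> val X \subset A &
    forall X, X \in D -> F \subset val X -> A \subset val X].
Proof.
move=> F0 /chainP cD.
have [/existsP[X0 /andP[X0D X0F]]|none] :=
    boolP [exists X in D, ~~ (F \subset val X)]; last first.
  exists set0; split=> [|| X XD FX|X _ _]; rewrite ?sub0set ?subset0 //; first by left.
  by move: none => /exists_inPn/(_ X XD); rewrite FX.
have [X /andP[XD XF] maxX] := @arg_maxnP _ X0
  (fun X => (X \in D) && ~~ (F \subset val X)) (fun X => #|val X|)
  (introT andP (conj X0D X0F)).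
exists (val X); split=> // [|Y YD YF|Y YD YF]; first by right; exists X.
  have /orP[//|XY] := cD Y X YD XD.
  suff -> : val X = val Y by [].
  by apply/eqP; rewrite eqEcard XY; apply: maxX; rewrite YD.
have /orP[//|YX] := cD X Y XD YD.
by rewrite (subset_trans YF YX) in XF.
Qed.

(** Expanding [h_F] at such a [j] involves only variables outside [D], so no squares arise when it
    multiplies the monomial of [D]. *)
Lemma chain_avoid (F : {set E}) D : F != set0 -> chainb D ->
  exists2 j, j \in F & forall X, X \in D -> j \in val X -> F \subset val X.
Proof.
move=> F0 cD; have [A [_ /subsetPn[j jF jA] Alow _]] := chain_split F0 cD.
exists j => // X XD jX; apply: contraNT jA => /(Alow X XD) XA.
exact: (subsetP XA).
Qed.

(* When [j] is chosen as in [chain_avoid], the sets [G] of [sum_gap] fill the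
   only gap of the chain [D] in the lattice of flats of [r]. *)
Lemma chain_gap_flats r (F : {set E}) D G j : rankfun r -> 2 <= r F ->
  (forall X, X \in D -> j \in val X -> F \subset val X) ->
  j \in F -> j \in val G -> ~~ (F \subset val G) -> chainb (G |: D) ->
  flats_of r (G |: D) -> flats_of (trunc F r) D.
Proof.
move=> rk F2 jD jF jG FG /chainP cC /forall_inP fC; have [_ _ mono sub] := rk.
apply/forall_inP => X XD; have fX : flatr r (val X) by rewrite fC ?setU1r.
have fG : flatr r (val G) by rewrite fC ?setU11.
have [FX|FX] := boolP (F \subset val X); first exact: trunc_flat_sub.
have jX : j \notin val X by apply: contra FX; apply: jD.
have XG : val X \subset val G.
  have /orP[//|GX] := cC X G (setU1r _ XD) (setU11 _ _).
  by rewrite (subsetP GX j jG) in jX.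
apply: trunc_flat_gap => //.
have := flatr_ltn rk fG FG; have := flatrP _ _ fX j jX.
have := sub (val X :|: F) (val G); rewrite setUAC (setUidPr XG).
have : r (j |: val X) <= r ((val X :|: F) :&: val G).
  by rewrite mono // subUset sub1set !inE jG jF orbT subsetI subsetUl XG.
lia.
Qed.

(** The witness is the closure of [j |: A] with [A] from [chain_split]. Its minimality makes any
    other candidate comparable to it, as [chain_gap_uniq] requires. *)
Lemma chain_gap_ex r (F : {set E}) D : rankfun r -> 2 <= r F -> chainb D ->
  (forall X, flatr r X -> is_flat M X) -> flats_of (trunc F r) D ->
  forall j, j \in F ->
  (forall X, X \in D -> j \in val X -> F \subset val X) ->
  exists2 G : npflat M, [&& j \in val G, ~~ (F \subset val G), chainb (G |: D)
    & flats_of r (G |: D)] & forall G' : npflat M, j \in val G' ->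
      chainb (G' |: D) -> flats_of r (G' |: D) -> val G \subset val G'.
Proof.
move=> rk F2 cD flM /forall_inP fD j jF jD; have [_ _ mono sub] := rk.
have F0 : F != set0 by apply/set0Pn; exists j.
have [A [AD0 FA Alow AD]] := chain_split F0 cD.
have fA' : flatr (trunc F r) A.
  case: AD0 => [->|[X XD ->]]; last exact: fD.
  exact: flatr0 (trunc_rankfun F rk).
have jA : j \notin A.
  case: AD0 FA => [->|[X XD ->]]; first by rewrite inE.
  by apply: contra; exact: jD.
have fA := trunc_flat rk fA'; have gap := trunc_gap rk F2 fA' FA.
have [G [fG AG rG minG]] := closure_ex (j |: A) rk.
have rjA : r G = (r A).+1.
  by apply/eqP; rewrite rG eqn_leq rankfunU1 //= (flatrP _ _ fA).
have jG : j \in G by rewrite (subsetP AG) ?setU11.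
have AG' : A \subset G := subset_trans (subsetUr _ _) AG.
(* [G] is only one rank above [A], whereas adjoining [F] to [A] raises the rank by at least two. *)
have FG : ~~ (F \subset G).
  apply/negP => FG; have : r (A :|: F) <= r G by rewrite mono // subUset AG'.
  lia.
have npG : npflat_pred M G.
  rewrite /npflat_pred flM //=; apply/andP; split.
    by apply/set0Pn; exists j.
  by apply: contra FG => /eqP ->; rewrite subsetT.
exists (exist _ G npG) => [|G' jG' /chainP cG' /forall_inP fG' /=]; last first.
  rewrite minG ?fG' ?setU11 // subUset sub1set jG'.
  case: AD0 FA => [->|[X XD ->]] FX; first by rewrite sub0set.
  have /orP[G'X|//] := cG' G' X (setU11 _ _) (setU1r _ XD).
  by rewrite jD ?(subsetP G'X) in FX.
rewrite /= jG FG /=; apply/andP; split.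
  apply: chainbU1 => // X XD /=; have [FX|FX] := boolP (F \subset val X).
    rewrite minG ?(trunc_flat rk (fD X XD)) // subUset sub1set AD // andbT.
    exact: (subsetP FX).
  by rewrite (subset_trans (Alow X XD FX)) ?orbT.
apply/forall_inP => X /setU1P[->//|XD]; exact: trunc_flat rk (fD X XD).
Qed.

(** Two distinct nested candidates would extend [D] to a chain of [r setT] flats, one more than
    [chain_card] allows. *)
Lemma chain_gap_uniq r (F : {set E}) D G G' j : rankfun r ->
  (#|D|.+2 = r setT) ->
  (forall X, X \in D -> j \in val X -> F \subset val X) ->
  (val G \subset val G') ->
  [&& j \in val G, ~~ (F \subset val G), chainb (G |: D) & flats_of r (G |: D)] ->
  [&& j \in val G', ~~ (F \subset val G'), chainb (G' |: D) & flats_of r (G' |: D)] ->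
  G = G'.
Proof.
move=> rk rT jD GG' /and4P[jG FG /chainP cG /forall_inP fG].
move=> /and4P[jG' FG' cG' /forall_inP fG'].
have GD : G \notin D by apply: contra FG => /jD ->.
have G'D : G' \notin D by apply: contra FG' => /jD ->.
apply/eqP; apply: contraT => neq.
have : #|G |: (G' |: D)| < r setT.
  apply: chain_card => //; first by rewrite -rT.
    apply: chainbU1 => // X /setU1P[->|XD]; first by rewrite GG'.
    by apply: cG; rewrite ?setU11 ?setU1r.
  by apply/forall_inP => X /setU1P[->|]; [apply: fG; rewrite setU11|apply: fG'].
by rewrite !cardsU1 in_setU1 negb_or neq GD G'D -rT; lia.
Qed.

(** This is the combinatorial content of multiplication by [h_F] acting as truncation: at most one
    [G] contributes, and one does exactly when [F] has rank at least two and [D] consists of flats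
    of the truncation. *)
Lemma sum_gap (R : pzSemiRingType) r (F : {set E}) D j : rankfun r -> chainb D ->
  #|D|.+2 = r setT -> (forall X, flatr r X -> is_flat M X) -> j \in F ->
  (forall X, X \in D -> j \in val X -> F \subset val X) ->
  (\sum_(G : npflat M | (j \in val G) && ~~ (F \subset val G))
     (chainb (G |: D) && flats_of r (G |: D))%:R =
   ((2 <= r F)%N && flats_of (trunc F r) D)%:R :> R)%R.
Proof.
move=> rk cD rTD flM jF jD; have [F2|F1] := leqP 2 (r F); last first.
  (* With [F] of rank at most one, a flat containing [j] contains all of [F], so no term
     survives. *)
  rewrite big1 // => G /andP[jG FG].
  have [/forall_inP fG|] := boolP (flats_of _ _); last by rewrite andbF.
  have := flatr_ltn rk (fG G (setU11 _ _)) FG; have [_ r1 mono sub] := rk.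
  have := sub (val G) F.
  have := mono [set j] (val G :&: F); rewrite r1 sub1set inE jG jF => /(_ isT).
  lia.
have [fD|nfD] := boolP (flats_of _ _); last first.
  rewrite big1 // => G /andP[jG FG]; have [/andP[cG fG]|//] := boolP (_ && _).
  by case/negP: nfD; exact: (chain_gap_flats rk F2 jD jF jG FG cG fG).
have [G hG minG] := chain_gap_ex rk F2 cD flM fD jF jD.
have /and4P[jG FG cG fG] := hG.
rewrite (bigD1 G) /=; last by rewrite jG.
rewrite cG fG /= big1 ?addr0 // => G' /andP[/andP[jG' FG'] neq].
have [/andP[cG' fG']|//] := boolP (_ && _).
case/eqP: neq; apply/esym.
by apply: (chain_gap_uniq rk rTD jD (minG G' jG' cG' fG') hG); apply/and4P.
Qed.

End Chains.

Local Open Scope ring_scope.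

(** * The degree map on products of the classes h_F *)

Section Degree.
Variables (R : realType) (E : finType) (M : matroid E) (d : nat) (i : E).
Variable deg : xring R M -> R.
Hypothesis degP : degree_map d deg.
Implicit Types (p q : xring R M) (C D : {set npflat M}) (G : npflat M).

Notation x := (@xvar R E M).

Lemma degD p q : deg (p + q) = deg p + deg q. Proof. by case: degP. Qed.
Lemma degZ c p : deg (c *: p) = c * deg p. Proof. by case: degP. Qed.

Lemma deg0 : deg 0 = 0.
Proof. by rewrite -(scale0r 0) degZ mul0r. Qed.

Lemma deg_sum (I : Type) (s : seq I) (P : pred I) (f : I -> xring R M) :
  deg (\sum_(k <- s | P k) f k) = \sum_(k <- s | P k) deg (f k).
Proof. exact: (big_morph deg degD deg0). Qed.

Lemma degMn p n : deg (p *+ n) = deg p *+ n.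
Proof. by elim: n => [|n IH]; rewrite ?mulr0n ?deg0 // !mulrSr degD IH. Qed.

Lemma deg_gen p q : chow_gen q -> deg (p * q) = 0.
Proof.
move=> gq; have [_ _ h _ _] := degP; apply: h; exists [:: (p, q)].
by split=> [r|]; [rewrite inE => /eqP -> | rewrite big_seq1].
Qed.

Lemma deg_nonchain p C : ~~ chainb C -> deg (p * \prod_(G in C) x G) = 0.
Proof.
rewrite negb_forall_in => /exists_inP[F FC]; rewrite negb_forall_in.
move=> /exists_inP[G GC]; rewrite negb_or => FG.
have GF : G != F by apply: contraL FG => /eqP ->; rewrite subxx.
rewrite (bigD1 F) //= (bigD1 G) /=; last by rewrite GC.
rewrite [x F * _]mulrA [x F * x G * _]mulrC mulrA; apply: deg_gen.
by left; exists F, G.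
Qed.

Lemma deg_hclass_indep p (F : flat2 M) j :
  deg (p * hclass R i F) = deg (p * hclass R j F).
Proof.
apply/eqP; rewrite -subr_eq0 -mulN1r.
have -> : deg (p * hclass R i F) + -1 * deg (p * hclass R j F) =
          deg (p * (alpha R M i - alpha R M j)).
  rewrite -degZ -degD scaleN1r -mulrBr; congr (deg (p * _)).
  by rewrite /hclass opprB addrA subrK.
by rewrite deg_gen //; right; exists i, j.
Qed.

Lemma hclass_mem j (F : flat2 M) : j \in val F ->
  hclass R j F = \sum_(G : npflat M | (j \in val G) && ~~ (val F \subset val G)) x G.
Proof.
move=> jF; rewrite /hclass /alpha (bigID (fun G : npflat M => val F \subset val G)) /=.
have -> : \sum_(G : npflat M | (j \in val G) && (val F \subset val G)) x G =
          \sum_(G : npflat M | val F \subset val G) x G.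
  by apply: eq_bigl => G; apply: andb_idl => /subsetP; apply.
by rewrite [LHS]addrC addKr.
Qed.

Lemma deg_hclass_expand (F : flat2 M) D j p : j \in val F ->
  (forall X, X \in D -> j \in val X -> val F \subset val X) ->
  deg (hclass R i F * p * \prod_(X in D) x X) =
  \sum_(G : npflat M | (j \in val G) && ~~ (val F \subset val G))
     deg (p * \prod_(X in G |: D) x X).
Proof.
move=> jF jD; rewrite -mulrA mulrC (deg_hclass_indep _ _ j) hclass_mem //.
rewrite mulr_sumr deg_sum; apply: eq_bigr => G /andP[jG FG].
rewrite big_setU1 /=; last by apply: contra FG => /jD ->.
by rewrite -mulrA [_ * x G]mulrC.
Qed.

Lemma chainb_max_chain C : loopless M -> mrank M setT = d.+1 ->
  chainb C -> #|C| = d -> max_chain C.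
Proof.
move=> lM rT cC sC; split; first exact/chainP.
move=> C' /chainP cC' sub; apply/eqP; rewrite eq_sym eqEcard sub /= sC -ltnS.
have := @chain_card _ _ (rank0 M) C' (rank0_rankfun lM); rewrite ffunE rT.
apply=> //; apply/forall_inP => G _.
by rewrite rank0_flat; have /and3P[] := valP G.
Qed.

Notation rank_of s := (foldr (@trunc E) (rank0 M) [seq val F | F : flat2 M <- s]).

(** The rank equation says that every truncation lowered the rank. The head of the list is expanded
    first but truncated last: the induction hypothesis evaluates the enlarged chains in the rank
    function of the tail, and [sum_gap] adds them up. *)
Lemma deg_prod_chain (s : seq (flat2 M)) D : loopless M -> mrank M setT = d.+1 ->
  chainb D -> (#|D| + size s)%N = d ->
  deg (\prod_(F <- s) hclass R i F * \prod_(X in D) x X) =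
  ((rank_of s setT + size s == d.+1)%N && flats_of (rank_of s) D)%:R.
Proof.
move=> lM rT; have rk0 := rank0_rankfun lM; have r0T : rank0 M setT = d.+1 by rewrite ffunE.
elim: s D => [|F s IH] D cD sD.
  rewrite big_nil mul1r /= addn0 r0T eqxx; rewrite addn0 in sD.
  have [_ _ _ _ ->] := degP; last exact: chainb_max_chain.
  suff -> : flats_of (rank0 M) D by [].
  by apply/forall_inP => G _; rewrite rank0_flat; have /and3P[] := valP G.
have F0 : val F != set0.
  have /andP[_ F2] := valP F; apply: contraTneq F2 => ->.
  by have [] := rk0; rewrite ffunE => ->.
have [j jF jD] := chain_avoid F0 cD.
rewrite big_cons (deg_hclass_expand _ jF jD).
have rk := foldr_trunc_rankfun [seq val G | G : flat2 M <- s] rk0.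
have le := foldr_trunc_setT [seq val G | G : flat2 M <- s] rk0.
rewrite size_map r0T in le.
have flM X : flatr (rank_of s) X -> is_flat M X.
  by move=> fX; rewrite -rank0_flat; exact: foldr_trunc_flat rk0 fX.
have -> : rank_of (F :: s) = trunc (val F) (rank_of s) by [].
have sE : size (F :: s) = (size s).+1 by [].
rewrite sE addnS in sD; rewrite sE addnS; set r := foldr _ _ _ in rk le flM IH *.
have {}IH (G : npflat M) : (j \in val G) && ~~ (val F \subset val G) ->
  deg (\prod_(F <- s) hclass R i F * \prod_(X in G |: D) x X) =
  [&& r setT + size s == d.+1, chainb (G |: D) & flats_of r (G |: D)]%N%:R.
  move=> /andP[jG FG]; have [cG|cG] := boolP (chainb _); last first.
    by rewrite deg_nonchain // andbF.
  rewrite IH // cardsU1 -sD; suff -> : G \notin D by rewrite add1n addSn.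
  by apply: contra FG => /jD ->.
rewrite (eq_bigr _ IH); have rF := trunc_setT (val F) rk.
(* If a truncation of the tail failed to lower the rank, the deficit persists and both sides are
   zero. *)
have [full|nfull] := eqVneq (r setT + size s)%N d.+1; last first.
  have -> : ((trunc (val F) r setT + size s).+1 == d.+1) = false by apply/eqP; lia.
  by rewrite big1.
have rTD : #|D|.+2 = r setT by lia.
have -> : ((trunc (val F) r setT + size s).+1 == d.+1) = (2 <= r (val F))%N.
  by case: (leqP 2 (r (val F))) rF => ? ?; apply/eqP; lia.
exact: sum_gap.
Qed.

End Degree.

(** * Signatures of real symmetric matrices *)

Lemma char_poly_simmx (R : comUnitRingType) n (P A : 'M[R]_n) : P \in unitmx ->
  char_poly (invmx P *m A *m P) = char_poly A.
Proof.
move=> Pu; have PP : map_mx polyC (invmx P) *m map_mx polyC P = 1%:M.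
  by rewrite -map_mxM mulVmx // map_mx1.
have -> : char_poly (invmx P *m A *m P) =
    \det (map_mx polyC (invmx P) *m char_poly_mx A *m map_mx polyC P).
  congr (\det _); rewrite /char_poly_mx mulmxBr mulmxBl !map_mxM.
  by rewrite mul_mx_scalar -scalemxAl PP scalemx1.
by rewrite !det_mulmx mulrAC -det_mulmx PP det1 mul1r.
Qed.

Section Signature.
Variables (R : realType) (n : nat).
Implicit Types (A : 'M[R]_n) (v l : 'rV[R]_n).
Local Notation C := R[i].
Local Notation toC := (real_complex R).
Local Notation ReC := (@complex.Re R).
Local Notation ImC := (@complex.Im R).

Definition qform A v : R := (v *m A *m v^T) 0 0.

Lemma qformE A v : qform A v = \sum_j \sum_k v 0 j * A j k * v 0 k.
Proof.
rewrite /qform mxE exchange_big; apply: eq_bigr => k _.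
by rewrite !mxE mulr_suml.
Qed.

Definition hform (B : 'M[C]_n) (z : 'rV[C]_n) : C :=
  \sum_j \sum_k z 0 j * B j k * (z 0 k)^*.

(** Diagonalisation takes place over the complex numbers; this identity carries its conclusions back
    to the real quadratic form. *)
Lemma Re_hform A z : ReC (hform (map_mx toC A) z) =
  qform A (map_mx ReC z) + qform A (map_mx ImC z).
Proof.
have ReD : {morph ReC : x y / x + y} by case=> [? ?] [? ?].
rewrite !qformE -big_split /hform (big_morph _ ReD (erefl _)); apply: eq_bigr => j _.
rewrite -big_split (big_morph _ ReD (erefl _)); apply: eq_bigr => k _.
rewrite !mxE; case: (z 0 j) => a b; case: (z 0 k) => c e.
by rewrite /=; ring.
Qed.

Lemma real_symmetric_spectral A : A^T = A -> exists (P : 'M[C]_n) (lam : 'I_n -> R),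
 [/\ P \in unitmx,
    map_mx toC A = invmx P *m diag_mx (\row_i (toC (lam i))) *m P &
    invmx P = (map_mx Num.conj P)^T].
Proof.
move=> sA; set B := map_mx toC A.
have Bh : B \is hermsymmx.
  apply: realsym_hermsym; last first.
    by apply/mxOverP => i j; rewrite mxE complex_real.
  apply/is_hermitianmxP; rewrite expr0 scale1r map_mx_id //.
  by rewrite /B map_trmx sA.
have Bn := hermitian_normalmx Bh.
have /mxOverP Br := hermitian_spectral_diag_real Bh.
exists (spectralmx B), (fun i => ReC (spectral_diag B 0 i)); split.
- exact: spectral_unit.
- rewrite [LHS](orthomx_spectralP Bn); congr (_ *m diag_mx _ *m _).
  by apply/rowP => i; rewrite mxE RRe_real.
by rewrite invmx_unitary ?spectral_unitarymx // map_trmx.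
Qed.

Lemma Re_hform_diag (B P : 'M[C]_n) (lam : 'I_n -> R) (c : 'rV[C]_n) :
  P \in unitmx -> B = invmx P *m diag_mx (\row_i (toC (lam i))) *m P ->
  invmx P = (map_mx Num.conj P)^T ->
  ReC (hform B (c *m P)) = \sum_m (ReC (c 0 m) ^+ 2 + ImC (c 0 m) ^+ 2) * lam m.
Proof.
move=> Pu defB Pinv.
have hE z : hform B z = (z *m B *m (map_mx Num.conj z)^T) 0 0.
  rewrite /hform mxE exchange_big; apply: eq_bigr => k _.
  by rewrite !mxE mulr_suml.
rewrite hE map_mxM trmx_mul -Pinv defB !mulmxA mulmxK // mulmxK //.
have ReD : {morph ReC : x y / x + y} by case=> [? ?] [? ?].
rewrite mxE (big_morph _ ReD (erefl _)); apply: eq_bigr => m _.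
rewrite mul_mx_diag !mxE; case: (c 0 m) => a b /=; ring.
Qed.

(** A vector of positive value forces a positive eigenvalue. Two nonnegative eigenvalues would give
    a plane of eigenvectors on which the form is nonnegative and which meets the hyperplane
    nontrivially; this excludes zero eigenvalues as well. *)
Lemma lorentz_signature_hyperplane A l : A^T = A ->
  (forall v, v != 0 -> \sum_j v 0 j * l 0 j = 0 -> qform A v < 0) ->
  (exists v, 0 < qform A v) -> lorentz_signature A.
Proof.
move=> sA neg [v0 pos]; have [P [lam [Pu defB Pinv]]] := real_symmetric_spectral sA.
have qP c : qform A (map_mx ReC (c *m P)) + qform A (map_mx ImC (c *m P)) =
    \sum_m (ReC (c 0 m) ^+ 2 + ImC (c 0 m) ^+ 2) * lam m.
  by rewrite -Re_hform (Re_hform_diag _ Pu defB Pinv).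
have q0 : qform A 0 = 0 by rewrite /qform !mul0mx mxE.
have [m0 lam0] : exists m, 0 < lam m.
  apply/existsP; apply: contraTT pos; rewrite negb_exists => /forallP npos.
  rewrite -leNgt; have := qP (map_mx toC v0 *m invmx P).
  rewrite mulmxKV //.
  have -> : map_mx ReC (map_mx toC v0) = v0 by apply/rowP => i; rewrite !mxE.
  have -> : map_mx ImC (map_mx toC v0) = 0 by apply/rowP => i; rewrite !mxE.
  rewrite q0 addr0 => ->; apply: sumr_le0 => m _.
  by rewrite mulr_ge0_le0 ?addr_ge0 ?sqr_ge0 // leNgt npos.
have uniq i k : 0 <= lam i -> 0 <= lam k -> i = k.
  move=> li lk; apply/eqP/negPn/negP => ik.
  (* The rows of [P] are eigenvectors and [lC i] is the value of [l] on row [i]; a single linear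
     equation in two unknowns has a nonzero solution. *)
  pose lC i : C := \sum_j P i j * toC (l 0 j).
  have [[a b] ab0 abl] : exists2 ab : C * C, ab != 0 & ab.1 * lC i + ab.2 * lC k = 0.
    have [l0|l0] := eqVneq (lC k) 0.
      by exists (0, 1); rewrite /= ?l0 ?mul0r ?mulr0 ?addr0 // -pair_eqE /= oner_eq0 andbF.
    exists (lC k, - lC i); last by rewrite /= mulNr mulrC subrr.
    by rewrite -pair_eqE /= negb_and l0.
  pose c : 'rV[C]_n := \row_m (if m == i then a else if m == k then b else 0).
  have cP j : (c *m P) 0 j = a * P i j + b * P k j.
    rewrite mxE (bigD1 i) //= (bigD1 k) 1?eq_sym //= big1 ?addr0.
      by rewrite !mxE eqxx eq_sym (negbTE ik) eqxx.
    by move=> m /andP[mi mk]; rewrite mxE (negbTE mi) (negbTE mk) mul0r.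
  have c0 : c != 0.
    apply: contraNneq ab0 => c0; have := c0 => /rowP/(_ i); rewrite !mxE eqxx => ->.
    by have := c0 => /rowP/(_ k); rewrite !mxE eqxx eq_sym (negbTE ik) => ->.
  have z0 : c *m P != 0.
    by apply: contra c0 => /eqP z0; rewrite -(mulmxK Pu c) z0 mul0mx.
  have lz : \sum_j (c *m P) 0 j * toC (l 0 j) = 0.
    rewrite -[RHS]abl /lC !mulr_sumr -big_split; apply: eq_bigr => j _.
    by rewrite cP mulrDl !mulrA.
  have := qP c; have ReD : {morph ReC : x y / x + y} by case=> [? ?] [? ?].
  have ImD : {morph ImC : x y / x + y} by case=> [? ?] [? ?].
  set z := c *m P in z0 lz *.
  (* Because [l] is real, the real and imaginary parts of [z] lie in the hyperplane separately. *)
  have lRe : \sum_j (map_mx ReC z) 0 j * l 0 j = 0.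
    have /(congr1 ReC) := lz; rewrite (big_morph _ ReD (erefl _)) => /= e.
    rewrite -[RHS]e; apply: eq_bigr => j _; rewrite mxE; case: (z 0 j) => ? ? /=; ring.
  have lIm : \sum_j (map_mx ImC z) 0 j * l 0 j = 0.
    have /(congr1 ImC) := lz; rewrite (big_morph _ ImD (erefl _)) => /= e.
    rewrite -[RHS]e; apply: eq_bigr => j _; rewrite mxE; case: (z 0 j) => ? ? /=; ring.
  have nonpos v : \sum_j v 0 j * l 0 j = 0 -> qform A v <= 0.
    by have [-> _|v0' /(neg _ v0')/ltW//] := eqVneq v 0; rewrite q0.
  have : 0 <= \sum_m (ReC (c 0 m) ^+ 2 + ImC (c 0 m) ^+ 2) * lam m.
    apply: sumr_ge0 => m _; rewrite mxE; case: eqP => [->|_].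
      by rewrite mulr_ge0 ?addr_ge0 ?sqr_ge0.
    case: eqP => [->|_]; first by rewrite mulr_ge0 ?addr_ge0 ?sqr_ge0.
    by rewrite /= expr0n /= addr0 mul0r.
  move=> ge0 eqq; move: ge0; rewrite -eqq; apply/negP; rewrite -ltNge.
  have := nonpos _ lRe; have := nonpos _ lIm.
  have [Re0|Re0] := eqVneq (map_mx ReC z) 0; last first.
    by have := neg _ Re0 lRe; lra.
  have [Im0|Im0] := eqVneq (map_mx ImC z) 0; last first.
    by have := neg _ Im0 lIm; lra.
  case/eqP: z0; apply/rowP => j.
  have /rowP/(_ j) := Re0; have /rowP/(_ j) := Im0; rewrite !mxE.
  by move: (\sum_j _) => [? ?] /= -> ->.
have negE i : (lam i < 0) = (i != m0).
  rewrite ltNge; congr (~~ _); apply/idP/eqP => [|->]; last exact: ltW.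
  by move=> li; apply: uniq => //; exact: ltW.
exists lam; split.
- apply: (map_poly_inj (real_complex R)).
  rewrite map_char_poly /= defB char_poly_simmx // rmorph_prod /=.
  rewrite char_poly_trig ?diag_mx_is_trig //; apply: eq_bigr => i _.
  by rewrite !mxE eqxx mulr1n rmorphB /= map_polyX map_polyC.
- rewrite (_ : [set _ | _] = [set m0]) ?cards1 //; apply/setP => i; rewrite !inE.
  apply/idP/eqP => [li|->//]; apply: uniq; exact: ltW.
rewrite (_ : [set _ | _] = [set~ m0]); last by apply/setP => i; rewrite !inE negE.
by rewrite cardsC1 card_ord.
Qed.

End Signature.

(** Such a relation is an equivalence on the elements related to themselves, so the form is the sum
    of the squares of the sums of [x] over the classes. *)
Lemma partial_equiv_form_ge0 (R : realDomainType) (I : finType) (p : rel I) (x : I -> R) :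
  ssrbool.symmetric p -> transitive p -> 0 <= \sum_j \sum_k (p j k)%:R * (x j * x k).
Proof.
move=> ps pt; pose cl j := [set k | p j k].
have clE j k : p j k = [&& p j j, p k k & cl k == cl j].
  apply/idP/and3P => [jk|[jj kk /eqP/setP/(_ j)]]; last by rewrite !inE jj ps.
  have kj : p k j by rewrite ps.
  split; [exact: pt kj|exact: pt jk|apply/eqP/setP => l; rewrite !inE].
  by apply/idP/idP; apply: pt.
suff -> : \sum_j \sum_k (p j k)%:R * (x j * x k) =
    \sum_(T : {set I}) (\sum_(j | p j j && (cl j == T)) x j) ^+ 2.
  by apply: sumr_ge0 => T _; apply: sqr_ge0.
rewrite (bigID (fun j => p j j)) /= [X in _ + X]big1 ?addr0; last first.
  by move=> j /negbTE jj; rewrite big1 // => k _; rewrite clE jj mul0r.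
rewrite (partition_big cl predT) //=; apply: eq_bigr => T _.
rewrite expr2 mulr_suml; apply: eq_bigr => j /andP[jj /eqP jT].
rewrite mulr_sumr [RHS]big_mkcond; apply: eq_bigr => k _.
by rewrite clE jj jT /=; case: (_ && _); rewrite ?mul1r ?mul0r.
Qed.

(* Up to the diagonal scaling [u], the form is [(\sum x)^2] minus a positive
   semidefinite form supported on the blocks of [p] and a positive diagonal. *)
Lemma lorentz_signature_blocks (R : realType) n (H : 'M[R]_n) (K delta tau : R)
    (u : 'I_n -> R) (p : rel 'I_n) :
  (0 < n)%N -> 0 < K -> 0 < delta -> delta <= 1 -> 0 < tau -> tau < 1 ->
  (forall j, 0 < u j) -> ssrbool.symmetric p -> transitive p ->
  (forall j k, H j k = K * (u j * u k) * (delta ^+ p j k * tau ^+ (j == k))) ->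
  lorentz_signature H.
Proof.
move=> n0 K0 d0 d1 t0 t1 u0 ps pt HE.
have formE (v : 'rV[R]_n) (x := fun j => u j * v 0 j) : qform H v =
    K * ((\sum_j x j) ^+ 2 - (1 - delta) * (\sum_j \sum_k (p j k)%:R * (x j * x k))
     - (1 - tau) * \sum_j delta ^+ p j j * x j ^+ 2).
  rewrite qformE expr2 mulr_suml !mulr_sumr -!sumrN -!big_split mulr_sumr.
  apply: eq_bigr => j _ /=; rewrite [(1 - tau) * _]mulrC.
  have -> : delta ^+ p j j * x j ^+ 2 * (1 - tau) =
      \sum_k (j == k)%:R * (delta ^+ p j k * (x j * x k) * (1 - tau)).
    rewrite (bigD1 j) //= eqxx big1 ?addr0 ?mul1r // => k kj.
    by rewrite eq_sym (negbTE kj) mul0r.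
  rewrite !mulr_sumr -!sumrN -!big_split mulr_sumr; apply: eq_bigr => k _ /=.
  rewrite HE /x; case: (p j k); case: eqP => _; rewrite ?expr1 ?expr0 ?mulr1n ?mulr0n; ring.
(* The hyperplane is the one where the scaled coordinates sum to zero, which removes the only
   positive square. *)
apply: (@lorentz_signature_hyperplane _ _ _ (\row_j u j)).
- by apply/matrixP => j k; rewrite mxE !HE eq_sym ps (mulrC (u k)).
- move=> v v0 lv; rewrite formE; set x := fun j => u j * v 0 j.
  have -> : \sum_j x j = 0.
    by rewrite -[RHS]lv; apply: eq_bigr => j _; rewrite mxE mulrC.
  have := partial_equiv_form_ge0 x ps pt; set S := \sum_j \sum_k _ => S0.
  have [j vj] : exists j, v 0 j != 0.
    apply/existsP; apply: contraNT v0 => /existsPn h.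
    by apply/eqP/rowP => j; rewrite mxE; apply/eqP/negPn/h.
  have : 0 < \sum_j delta ^+ p j j * x j ^+ 2.
    rewrite (bigD1 j) //= ltr_wpDr //.
      by apply: sumr_ge0 => k _; rewrite mulr_ge0 ?sqr_ge0 // exprn_ge0 // ltW.
    have xj : x j != 0 by rewrite mulf_neq0 // lt0r_neq0.
    by apply: mulr_gt0; [exact: exprn_gt0|rewrite lt_def sqrf_eq0 xj sqr_ge0].
  move=> T0; rewrite expr0n /= sub0r pmulr_rlt0 //.
  have : 0 <= (1 - delta) * S by rewrite mulr_ge0 // subr_ge0.
  have : 0 < (1 - tau) * \sum_j delta ^+ p j j * x j ^+ 2 by rewrite mulr_gt0 // subr_gt0.
  lra.
exists (\row_j (j == Ordinal n0)%:R); rewrite qformE.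
rewrite (bigD1 (Ordinal n0)) //= [X in _ + X]big1 ?addr0; last first.
  by move=> j /negbTE j0; rewrite big1 // => k _; rewrite !mxE j0 !mul0r.
rewrite (bigD1 (Ordinal n0)) //= big1 ?addr0; last first.
  by move=> k /negbTE k0; rewrite !mxE k0 mulr0.
by rewrite !mxE eqxx mul1r mulr1 HE !mulr_gt0 ?exprn_gt0.
Qed.

(** * Coefficients of multivariate polynomials *)

Section Multinomials.
Variable n : nat.
Implicit Types a b : 'X_{1..n}.

Definition mfact a := (\prod_(j < n) (a j)`!)%N.

Lemma mfact_gt0 a : (0 < mfact a)%N.
Proof. by rewrite prodn_gt0 // => j; rewrite fact_gt0. Qed.

Lemma mfactDU a j : mfact (a + U_(j)) = ((a j).+1 * mfact a)%N.
Proof.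
rewrite /mfact (bigD1 j) //= [in RHS](bigD1 j) //= mnmDE mnm1E eqxx addn1 factS mulnA.
congr (_ * _)%N; apply: eq_bigr => k kj.
by rewrite mnmDE mnm1E eq_sym (negbTE kj) addn0.
Qed.

Lemma m2s_addU a j : perm_eq (m2s (a + U_(j))) (j :: m2s a).
Proof.
have cnt b k : count_mem k (m2s b) = b k by rewrite -[in RHS](s2mK b) mnmE.
by apply/allP => k _ /=; rewrite !cnt mnmDE mnm1E addnC.
Qed.

Lemma mnm_neq0 a : a != 0%MM -> exists b j, a = (b + U_(j))%MM.
Proof.
move=> a0; have [j aj] : exists j, a j != 0%N.
  apply/existsP; apply: contraNT a0 => /existsPn h.
  by apply/eqP/mnmP => j; rewrite mnm0E; apply/eqP/negPn/h.
exists (a - U_(j))%MM, j; rewrite submK //.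
by apply/mnm_lepP => k; rewrite mnm1E; case: eqP => // <-; rewrite lt0n.
Qed.

(** In the exponent of [theta], the terms in [b j] and [b k] go into the diagonal scaling; the last
    one singles out the diagonal of the Hessian. *)
Lemma sum_sqrDU b j k : (\sum_l (b + U_(k) + U_(j))%MM l ^ 2 =
  \sum_l b l ^ 2 + 2 + 2 * b j + 2 * b k + 2 * (j == k))%N.
Proof.
have S1 a l : (\sum_m (a + U_(l))%MM m ^ 2 = \sum_m a m ^ 2 + 2 * a l + 1)%N.
  rewrite (bigD1 l) //= [in RHS](bigD1 l) //= mnmDE mnm1E eqxx.
  rewrite (eq_bigr (fun m => (a m ^ 2)%N)) => [|m ml].
    by rewrite sqrnD muln1 exp1n; lia.
  by rewrite mnmDE mnm1E eq_sym (negbTE ml) addn0.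
by rewrite !S1 mnmDE mnm1E eq_sym; lia.
Qed.

Lemma prod_m2s (S : comNzRingType) (h : 'I_n -> S) a :
  \prod_(j <- m2s a) h j = \prod_(j < n) h j ^+ a j.
Proof.
rewrite /m2s big_flatten big_map big_enum; apply: eq_bigr => j _.
by rewrite big_nseq iter_mulr_1.
Qed.

Lemma mderiv_exp (S : comNzRingType) j (p : {mpoly S[n]}) k :
  mderiv j (p ^+ k.+1) = mderiv j p * p ^+ k *+ k.+1.
Proof.
elim: k => [|k IH]; first by rewrite !expr1 expr0 mulr1.
by rewrite exprS mderivM IH mulrnAr mulrCA -exprS addrC -mulrSr.
Qed.

(** The multinomial theorem, by induction on [d]: a coefficient at a nonzero exponent is read off
    from a partial derivative of the power. *)
Lemma mcoeff_linear_exp (S : comNzRingType) (c : 'I_n -> S) d a :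
  ((\sum_(j < n) (c j)%:MP * 'X_j) ^+ d)@_a *+ mfact a =
  if mdeg a == d then (\prod_(j < n) c j ^+ a j) *+ d`! else 0.
Proof.
elim: d a => [|d IH] a.
  rewrite expr0 mcoeff1 mdeg_eq0; case: eqP => [->|_]; last by rewrite mul0rn.
  by rewrite /mfact !big1 // => j _; rewrite mnm0E.
have [->|/mnm_neq0[b [j ->]]] := eqVneq a 0%MM.
  rewrite mdeg0 eq_sym /= rmorphXn /= raddf_sum big1 ?expr0n ?mul0rn // => j _ /=.
  rewrite mcoeffCM mcoeffX; case: eqP => [/mnmP/(_ j)|_]; last by rewrite mulr0.
  by rewrite mnm1E mnm0E eqxx.
rewrite mfactDU mulrnA -mcoeff_mderiv mderiv_exp.
have -> : mderiv j (\sum_(k < n) (c k)%:MP * 'X_k) = (c j)%:MP.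
  rewrite raddf_sum (bigD1 j) //= big1 ?addr0 => [|k kj].
    by rewrite mderiv_mulC mderivX mnm1E eqxx scale1r -[X in (X - _)%MM]add0m addmK mpolyX0 mulr1.
  by rewrite mderiv_mulC mderivX mnm1E (negbTE kj) scale0r mulr0.
rewrite mcoeffMn mcoeffCM mulrnAC -mulrnAr IH mdegD mdeg1 addn1 eqSS.
case: eqP => _; last by rewrite mulr0 mul0rn.
rewrite mulrnAr -mulrnA mulnC -factS; congr (_ *+ _).
rewrite [in RHS](bigD1 j) //= [in LHS](bigD1 j) //= mulrA -exprS.
rewrite mnmDE mnm1E eqxx addn1; congr (_ * _); apply: eq_bigr => k kj.
by rewrite mnmDE mnm1E eq_sym (negbTE kj) addn0.
Qed.

Lemma mpoly_of_coeffs (R : nzRingType) d (c : 'X_{1..n} -> R) :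
  exists2 g : {mpoly R[n]}, g \is d.-homog &
    forall a, g@_a = if mdeg a == d then c a else 0.
Proof.
pose E a := if mdeg a == d then c a else 0.
pose g := \sum_(a : 'X_{1..n < d.+1}) E a *: 'X_[a] : {mpoly R[n]}.
have gE a : g@_a = E a.
  have [le|lt] := ltnP (mdeg a) d.+1; first by rewrite mcoeff_mpoly.
  rewrite /E; case: eqP => [e|_]; first by rewrite e ltnn in lt.
  rewrite raddf_sum big1 // => b _; rewrite /= mcoeffZ mcoeffX.
  case: eqP => [e|_]; last by rewrite mulr0.
  by have := bmdeg b; rewrite e ltnNge lt.
exists g => //; apply/dhomogP => a; rewrite mcoeff_msupp gE /E.
by have [//|_] := eqVneq (mdeg a) d; rewrite eqxx.
Qed.

(** On coefficients normalised by [mfact], differentiation is a mere shift of the exponent. *)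
Lemma mcoeff_foldr_mderiv (R : nzRingType) (f : {mpoly R[n]}) (c : 'X_{1..n} -> R)
    (s : seq 'I_n) : (forall a, f@_a *+ mfact a = c a) ->
  forall a, (foldr (fun i p => mderiv i p) f s)@_a *+ mfact a =
    c (a + \sum_(j <- s) U_(j))%MM.
Proof.
move=> fc; elim: s => [|j s IH] a /=; first by rewrite big_nil addm0 fc.
rewrite mcoeff_mderiv -mulrnA -mfactDU IH big_cons addmA; congr (c (_ + _)%MM).
Qed.

End Multinomials.

(** * The volume polynomial *)

Lemma bernoulli_le (R : realDomainType) (x : R) m : 0 <= x -> x <= 1 ->
  1 - (1 - x) ^+ m <= m%:R * x.
Proof.
move=> x0 x1; elim: m => [|m IH]; first by rewrite expr0 subrr mul0r.
rewrite exprS -natr1; have m0 : 0 <= m%:R :> R by [].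
have := ler_wpM2l x0 IH; have : 0 <= x * (1 - x) ^+ m; last by nra.
by rewrite mulr_ge0 // exprn_ge0 // subr_ge0.
Qed.

Section Volume.
Variables (R : realType) (E : finType) (M : matroid E) (d : nat) (i : E).
Variable deg : xring R M -> R.
Hypotheses (lM : loopless M) (rankT : mrank M setT = d.+1) (degP : degree_map d deg).
Implicit Types (a b : 'X_{1..#|flat2 M|}) (j k : 'I_#|flat2 M|).

Definition nth_flat j : {set E} := val (@enum_val (flat2 M) (flat2 M) j).

Definition trunc_rank a := foldr (@trunc E) (rank0 M) [seq nth_flat j | j <- m2s a].

Lemma trunc_rank_rankfun a : rankfun (trunc_rank a).
Proof. exact/foldr_trunc_rankfun/rank0_rankfun. Qed.

Lemma trunc_rankDU a j : trunc_rank (a + U_(j)) = trunc (nth_flat j) (trunc_rank a).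
Proof.
rewrite /trunc_rank (foldr_trunc_perm (rank0_rankfun lM) (perm_map _ (m2s_addU a j))).
by [].
Qed.

Lemma trunc_rank_setT_gt0 a : (0 < trunc_rank a setT)%N.
Proof.
apply: foldr_trunc_setT_gt0; first exact: rank0_rankfun.
by rewrite ffunE rankT.
Qed.

Lemma trunc_rank_setT_ge a : (d.+1 <= trunc_rank a setT + mdeg a)%N.
Proof.
have := foldr_trunc_setT [seq nth_flat j | j <- m2s a] (rank0_rankfun lM).
by rewrite size_map size_m2s ffunE rankT.
Qed.

(** The multinomial theorem reduces this to [deg_prod_chain] for the empty chain, where [d]
    effective truncations leave rank one. *)
Lemma mcoeff_volume a :
  (volume_poly d deg i)@_a *+ mfact a =
  if mdeg a == d then (trunc_rank a setT == 1%N)%:R *+ d`! else 0.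
Proof.
have -> : (volume_poly d deg i)@_a = deg ((thsum R M i ^+ d)@_a).
  rewrite /volume_poly raddf_sum /=; have [aP|aP] := boolP (a \in msupp (thsum R M i ^+ d)).
    rewrite (bigD1_seq a) ?msupp_uniq //= big1 ?addr0.
      by rewrite mcoeffZ mcoeffX eqxx mulr1.
    by move=> b ba; rewrite mcoeffZ mcoeffX (negbTE ba) mulr0.
  rewrite (memN_msupp_eq0 aP) (deg0 degP) big_seq big1 // => b bP.
  rewrite mcoeffZ mcoeffX; case: eqP => [eba|_]; last by rewrite mulr0.
  by rewrite -eba bP in aP.
pose h j := hclass R i (@enum_val (flat2 M) (flat2 M) j).
have thE : thsum R M i = \sum_j (h j)%:MP * 'X_j.
  rewrite /thsum (reindex _ (onW_bij _ (@enum_val_bij (flat2 M)))) /=.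
  by apply: eq_bigr => j _; rewrite /h enum_valK.
rewrite -(degMn degP) thE mcoeff_linear_exp; case: eqP => [da|_]; last exact: deg0 degP.
rewrite (degMn degP) -prod_m2s; congr (_ *+ _).
have -> : \prod_(j <- m2s a) h j =
    \prod_(F <- [seq @enum_val (flat2 M) (flat2 M) j | j <- m2s a]) hclass R i F *
    \prod_(X in set0) xvar R X by rewrite big_map big_set0 mulr1.
rewrite (deg_prod_chain i degP lM rankT).
- rewrite -map_comp size_map size_m2s da -[d.+1]add1n eqn_add2r.
  suff -> : flats_of (trunc_rank a) (set0 : {set npflat M}) by rewrite andbT.
  by apply/forall_inP => X; rewrite inE.
- by apply/chainP => X Y; rewrite inE.
by rewrite cards0 size_map size_m2s.
Qed.

Section Weights.
Variables delta theta : R.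
Hypotheses (d0 : 0 < delta) (d1 : delta <= 1) (t0 : 0 < theta) (t1 : theta < 1).

(** The rank is always positive, so the exponent of [delta] is zero only at rank one. The quadratic
    exponent of [theta] shrinks the diagonal of each Hessian, which makes the signature
    nondegenerate. *)
Definition weight a : R :=
  delta ^+ (trunc_rank a setT).-1 * theta ^+ (\sum_j a j ^ 2)%N.

Lemma weight_gt0 a : 0 < weight a.
Proof. by rewrite mulr_gt0 ?exprn_gt0. Qed.

(** This provides a variable, without which no Hessian could have a positive eigenvalue. *)
Lemma flat2_setT : (2 <= d)%N -> flat2_pred M setT.
Proof.
move=> d2; rewrite /flat2_pred rankT ltnS (ltnW d2) andbT.
by apply/forallP => e; rewrite inE.
Qed.

Lemma weight_signature b (H : 'M[R]_#|flat2 M|) (c : R) : 0 < c -> (mdeg b + 2 = d)%N ->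
  (forall j k, H j k = c * weight (b + U_(k) + U_(j))) -> lorentz_signature H.
Proof.
move=> c0 db HE; have rk := trunc_rank_rankfun b; set r := trunc_rank b in rk *.
(* Each of the [d - 2] truncations costs at most one rank, so [r setT - 3] below is a true
   difference. *)
have r3 : (3 <= r setT)%N by have := trunc_rank_setT_ge b; rewrite -/r; lia.
pose e j := (2 <= r (nth_flat j))%N.
pose p : rel _ := fun j k => [&& e j, e k & (r (nth_flat j :|: nth_flat k) <= 2)%N].
(* The exponent [r setT - 3] belongs to two effective truncations. A flat of rank at most one under
   [r] does not lower the rank, and its factor [delta] goes into the scaling. *)
apply: (@lorentz_signature_blocks _ _ _
  (c * (delta ^+ (r setT - 3) * theta ^+ (\sum_l b l ^ 2 + 2))) delta (theta ^+ 2)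
  (fun j => delta ^+ (1 - e j) * theta ^+ (2 * b j)) p) => //.
- apply/card_gt0P; have d2 : (2 <= d)%N by lia.
  by exists (exist _ setT (flat2_setT d2)).
- by rewrite !mulr_gt0 ?exprn_gt0.
- by rewrite exprn_gt0.
- by rewrite exprn_ilt1 // ltW.
- by move=> j; rewrite mulr_gt0 ?exprn_gt0.
- by move=> j k; rewrite /p setUC; case: (e j); case: (e k).
- move=> k j l /and3P[ej ek jk] /and3P[_ el kl]; rewrite /p ej el /=.
  exact: rank2_trans rk ek jk kl.
move=> j k; rewrite HE /weight sum_sqrDU !trunc_rankDU -/r.
have := trunc_trunc_setT (nth_flat k) (nth_flat j) rk.
have -> : [&& 1 < r (nth_flat k), 1 < r (nth_flat j) &
    r (nth_flat k :|: nth_flat j) <= 2]%N = p j k.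
  by rewrite /p /e setUC; case: (_ < r _)%N; case: (_ < r _)%N.
set T := trunc _ _ _; rewrite -/(e k) -/(e j) => eT.
have -> : T.-1 = (r setT - 3 + (1 - e j) + (1 - e k) + p j k)%N.
  move: eT r3; rewrite /p. move: (e j) (e k) (_ <= 2)%N (r setT) => [] [] [] N; lia.
have reorder (x0 x1 x2 x3 y0 y1 y2 y3 : R) : c * (x0 * x1 * x2 * x3 * (y0 * y1 * y2 * y3)) =
    c * (x0 * y0) * (x1 * y1 * (x2 * y2)) * (x3 * y3) by ring.
move: (2 * b j)%N (2 * b k)%N => m1 m2.
rewrite -exprM; move: (2 * (j == k))%N => m3; rewrite !exprD; exact: reorder.
Qed.

Lemma weight_strictly_lorentzian (g : {mpoly R[#|flat2 M|]}) :
  g \is d.-homog ->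
  (forall a, g@_a *+ mfact a = if mdeg a == d then d`!%:R * weight a else 0) ->
  strictly_lorentzian d g.
Proof.
move=> gh gE; split=> // [a da|d2 s].
  have := gE a; rewrite da eqxx => ga.
  by rewrite -(pmulrn_lgt0 _ (mfact_gt0 a)) ga mulr_gt0 ?weight_gt0 // ltr0n fact_gt0.
pose b : 'X_{1..#|flat2 M|} := (\sum_(j <- s) U_(j))%MM.
have db : mdeg b = (d - 2)%N.
  rewrite /b mdeg_sum (eq_bigr (fun _ => 1%N)) => [|j _]; last exact: mdeg1.
  by rewrite sum1_size size_tuple.
apply: (@weight_signature b _ d`!%:R); first by rewrite ltr0n fact_gt0.
  by rewrite db subnK.
move=> j k; rewrite mxE.
(* A Hessian entry is the constant term of a derivative of order [d], and [mfact] is one at the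
   exponent zero. *)
have := mcoeff_foldr_mderiv [:: j, k & s] gE 0%MM.
rewrite /= /mfact big1 ?mulr1n => [->|l _]; last by rewrite mnm0E.
rewrite add0m !big_cons -/b.
have -> : (U_(j) + (U_(k) + b) = b + U_(k) + U_(j))%MM.
  by apply/mnmP => l; rewrite !mnmDE; lia.
by rewrite !mdegD !mdeg1 db -addnA subnK // eqxx.
Qed.
End Weights.
End Volume.

Theorem theorem5p13 (R : realType) (E : finType) (M : matroid E) (d : nat)
    (i : E) (deg : xring R M -> R) :
  loopless M ->
  mrank M setT = d.+1 ->
  degree_map d deg ->
  lorentzian d (volume_poly d deg i).
Proof.
move=> lM rankT degP eps eps0.
have df0 : 0 < d`!%:R :> R by rewrite ltr0n fact_gt0.
have K0 : 0 < d`!%:R * ((d ^ 2).+2)%:R :> R by rewrite mulr_gt0.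
(* [eta] serves both as [delta] and as [1 - theta]; the denominator ensures [eta < 1] and the bound
   [etaB]. *)
pose eta : R := eps / (eps + d`!%:R * ((d ^ 2).+2)%:R).
have den0 : 0 < eps + d`!%:R * ((d ^ 2).+2)%:R by rewrite addr_gt0.
have eta0 : 0 < eta by rewrite divr_gt0.
have eta1 : eta < 1 by rewrite ltr_pdivrMr // mul1r ltrDl.
have etaB : d`!%:R * (((d ^ 2).+1)%:R * eta) < eps.
  rewrite /eta !mulrA ltr_pdivrMr // mulrC ltr_pM2l //.
  by rewrite ltr_wpDl ?ltW // ltr_pM2l // ltr_nat.
pose w : 'X_{1..#|flat2 M|} -> R := weight eta (1 - eta).
have [g gh gE] := mpoly_of_coeffs d (fun a => d`!%:R * w a / (mfact a)%:R : R).
have gE' a : g@_a *+ mfact a = if mdeg a == d then d`!%:R * w a else 0.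
  rewrite gE; case: eqP => _; last by rewrite mul0rn.
  by rewrite -[LHS]mulr_natr divfK // pnatr_eq0 -lt0n mfact_gt0.
exists g; split.
  apply: (@weight_strictly_lorentzian _ _ _ _ _ _ eta (1 - eta)) => //; rewrite ?subr_gt0 //.
  - exact: ltW.
  - by rewrite gtrBl.
move=> a; apply: le_lt_trans etaB.
(* Multiplying the difference by [mfact a] can only enlarge it and gives access to the normalised
   coefficients. *)
have m1 : 1 <= (mfact a)%:R :> R by rewrite ler1n mfact_gt0.
apply: (@le_trans _ _ (`|(volume_poly d deg i)@_a - g@_a| * (mfact a)%:R)).
  by rewrite ler_peMr.
rewrite -{1}[(mfact a)%:R]ger0_norm // -normrM mulrBl !mulr_natr.
rewrite mcoeff_volume // gE'; case: eqP => [da|_]; last first.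
  by rewrite subrr normr0; do 2!apply: mulr_ge0 => //; exact: ltW.
rewrite -[X in X - _]mulr_natl -mulrBr normrM ger0_norm ?(ltW df0) // ler_pM2l //.
have t0 : 0 <= 1 - eta by rewrite subr_ge0 ltW.
have t1 : 1 - eta <= 1 by rewrite gerBl ltW.
have w0 : 0 <= w a by rewrite mulr_ge0 ?exprn_ge0 // ltW.
(* At rank one the weight is a power of [1 - eta] to be compared with 1: its exponent, a sum of
   squares, is at most [d ^ 2], and Bernoulli's inequality applies. At higher rank the weight is
   compared with 0 and contains a factor [eta]. *)
case: eqP => [r1|r1].
  have w1 : w a <= 1 by rewrite mulr_ile1 ?exprn_ge0 ?exprn_ile1 // ltW.
  rewrite ger0_norm ?subr_ge0 // /w /weight r1 expr0 mul1r.
  apply: le_trans (bernoulli_le _ (ltW eta0) (ltW eta1)) _.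
  rewrite ler_pM2r // ler_nat ltnW // ltnS -da mdegE.
  have -> : ((\sum_j a j) ^ 2 = \sum_j a j * (\sum_k a k))%N by rewrite -big_distrl.
  by apply: leq_sum => j _; rewrite leq_mul2l (bigD1 j) // leq_addr orbT.
rewrite sub0r normrN ger0_norm //.
have r2 : (1 < trunc_rank a setT)%N.
  by have := trunc_rank_setT_gt0 lM rankT a; case: (trunc_rank a _) r1 => // -[].
rewrite /w /weight -[(trunc_rank a setT).-1]prednK; last by lia.
apply: (@le_trans _ _ eta).
  by rewrite exprS -mulrA ler_piMr ?(ltW eta0) //
    mulr_ile1 ?exprn_ge0 ?exprn_ile1 ?(ltW eta0) ?(ltW eta1) //.
by rewrite ler_peMl ?(ltW eta0) // ler1n.
Qed.
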